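(* For every finite simple graph $G$ and every edge $e$ of $G$, $-2\le \mathrm{Z}_{(1)}(G)-\mathrm{Z}_{(1)}(G-e)$.
   Context: $G-e$ is the graph obtained from $G$ by deleting the edge $e$ (keeping all vertices). Zero forcing color change rule: a blue vertex $u$ may force (color blue) a white vertex $v$ if $v$ is the only white neighbor of $u$. A leak is a vertex that is not allowed to perform a force. A set $B\subseteq V(G)$ is a $1$-leaky forcing set of $G$ if for every choice of a single vertex as a leak, starting with exactly $B$ blue (all others white) and iteratively applying the color change rule, with the leak not allowed to force, eventually colors all of $V(G)$ blue. $\mathrm{Z}_{(1)}(G)$ is the minimum size of a $1$-leaky forcing set of $G$. *)

(* Defs.v *)
From mathcomp Require Import all_boot.

Set Implicit Arguments.
Unset Strict Implicit.
Unset Printing Implicit Defensive.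

Record sgraph (V : finType) := SGraph {
  adj :> rel V;
  adj_sym : symmetric adj;
  adj_irr : irreflexive adj
}.

Section LeakyForcing.
Variable V : finType.
Implicit Types (G : sgraph V) (B : {set V}) (e : {set V}) (leak u v w : V).

Definition edges G : {set {set V}} :=
  [set e | [exists u, exists v, adj G u v && (e == [set u; v])]].

Definition del_edge_rel G e : rel V :=
  fun u v => adj G u v && ([set u; v] != e).

Lemma del_edge_sym G e : symmetric (del_edge_rel G e).
Proof. by move=> u v; rewrite /del_edge_rel adj_sym setUC. Qed.

Lemma del_edge_irr G e : irreflexive (del_edge_rel G e).
Proof. by move=> u; rewrite /del_edge_rel adj_irr. Qed.

Definition del_edge G e : sgraph V :=
  SGraph (@del_edge_sym G e) (@del_edge_irr G e).

(* When B is the set of blue vertices, u may force v. *)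
Definition can_force G B u v : bool :=
  (u \in B) && ([set w | adj G u w & w \notin B] == [set v]).

Definition force_step G leak : rel {set V} :=
  fun B B' =>
    [exists u, exists v, [&& u != leak, can_force G B u v & B' == v |: B]].

Definition leaky_forcing1 G B : bool :=
  [forall leak, connect (force_step G leak) B [set: V]].

(* The full vertex set is a valid default for [arg min], as it is always
   leaky forcing; see Z1_min. *)
Definition Z1 G : nat := #|[arg min_(B < [set: V] | leaky_forcing1 G B) #|B|]|.

Lemma leaky_forcing1T G : leaky_forcing1 G [set: V].
Proof. by apply/forallP => leak; exact: connect0. Qed.

Lemma Z1_witness G : exists2 B, leaky_forcing1 G B & #|B| = Z1 G.
Proof.
rewrite /Z1; case: arg_minnP => [|B fB _]; first exact: leaky_forcing1T.
by exists B.
Qed.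

Lemma Z1_min G B : leaky_forcing1 G B -> Z1 G <= #|B|.
Proof.
by rewrite /Z1; case: arg_minnP => [|B' _ minB' /minB'//]; exact: leaky_forcing1T.
Qed.

End LeakyForcing.

(* Main.v *)
(* Adding both ends of e to a 1-leaky forcing set of G gives a 1-leaky forcing
   set of G - e.  Every force x -> y of G either has y already blue, or has y
   outside e; then the edge xy survives in G - e, and y is still the only white
   neighbor of x there. *)
Require Import Defs.
From mathcomp Require Import all_boot all_order all_algebra.
From mathcomp Require Import zify.

Set Implicit Arguments.
Unset Strict Implicit.
Unset Printing Implicit Defensive.

Import Order.TTheory GRing.Theory Num.Theory.
Local Open Scope ring_scope.

(** Enlarging the blue set and deleting an edge can only shrink the white neighborhood of [x]; the
    conditions on [e] and [y] keep [y] itself in it. *)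
Lemma can_force_del_edge (V : finType) (G : sgraph V) (e S T : {set V}) (x y : V) :
  S \subset T -> e \subset T -> y \notin T ->
  can_force G S x y -> can_force (del_edge G e) T x y.
Proof.
move=> sST seT yT /andP[xS /eqP white]; rewrite /can_force (subsetP sST x xS) /=.
have white_in w : adj G x w -> w \notin S -> w = y.
  by move=> xw wS; apply/set1P; rewrite -white inE xw.
have: y \in [set w | adj G x w & w \notin S] by rewrite white set11.
rewrite inE => /andP[xy _].
apply/eqP/setP => w; rewrite !inE /= /del_edge_rel.
apply/idP/eqP => [/andP[/andP[xw _] wT] | ->].
  by apply: white_in xw _; apply: contra wT; apply: (subsetP sST).
(* Were [xy] the deleted edge, [y] would lie in [e], hence in [T]. *)
rewrite xy yT andbT /=; apply: contra yT => /eqP exy.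
by apply: (subsetP seT); rewrite -exy set22.
Qed.

(** The chain of forces from [S] is replayed from [T] by the same forcing vertices, so the leak is
    respected. The invariant is that the blue set in [G - e] contains [e] and the blue set in
    [G]. *)
Lemma connect_force_step_del_edge (V : finType) (G : sgraph V) (e : {set V})
    (leak : V) (S T : {set V}) :
  S \subset T -> e \subset T -> connect (force_step G leak) S [set: V] ->
  connect (force_step (del_edge G e) leak) T [set: V].
Proof.
move=> sST seT /connectP[p]; elim: p S T sST seT => [|S' p IHp] S T sST seT /=.
  by move=> _ S_T; move: sST; rewrite -S_T subTset => /eqP->; exact: connect0.
case/andP=> /existsP[x /existsP[y /and3P[x_leak xy /eqP->]]] S'p lastp.
have [yT | yT] := boolP (y \in T).
  (* This force is skipped: [T] already contains [y |: S]. *)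
  by apply: IHp S'p lastp; rewrite // subUset sub1set yT.
apply: (@connect_trans _ _ (y |: T)); last first.
  by apply: IHp S'p lastp; [exact: setUS | exact: subset_trans (subsetUr _ _)].
apply/connect1/existsP; exists x; apply/existsP; exists y.
by rewrite x_leak eqxx andbT; apply: can_force_del_edge xy.
Qed.

Lemma leaky_forcing1_del_edge (V : finType) (G : sgraph V) (e B : {set V}) :
  leaky_forcing1 G B -> leaky_forcing1 (del_edge G e) (B :|: e).
Proof.
move=> /forallP fB; apply/forallP => leak.
exact: connect_force_step_del_edge (subsetUl _ _) (subsetUr _ _) (fB leak).
Qed.

Lemma card_edge (V : finType) (G : sgraph V) (e : {set V}) :
  e \in edges G -> #|e| = 2%N.
Proof.
rewrite inE => /existsP[u /existsP[v /andP[uv /eqP->]]].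
by rewrite cards2; case: eqVneq uv => // ->; rewrite adj_irr.
Qed.

Theorem theorem3p8 (V : finType) (G : sgraph V) (e : {set V}) (he : e \in edges G) :
  (-2 : int) <= (Z1 G)%:Z - (Z1 (del_edge G e))%:Z.
Proof.
have [B fB cardB] := Z1_witness G.
have := Z1_min (leaky_forcing1_del_edge e fB).
(* Inclusion-exclusion bounds the size of [B :|: e] by [Z1 G + 2]. *)
have := cardsUI B e; rewrite (card_edge he) cardB.
lia.
Qed.
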